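(* Let $m_1,m_2,m_3>0$, $M=m_1+m_2+m_3$, and let $t\mapsto(z_1(t),z_2(t),z_3(t))$ be a collision-free solution, defined on an interval $[0,a)$ with $0<a\le+\infty$, of the Newtonian planar three-body problem with masses $m_1,m_2,m_3$ and center of mass at the origin, having zero angular momentum. Suppose that the configuration at $t=0$ is not a syzygy, and that there are constants $0<\alpha<\beta$ such that during the motion $$\alpha\le |z_i(t)-z_j(t)|\le\beta\quad\text{for all } i<j.$$ Put $\theta_\alpha=\sqrt{M}/\alpha^{3/2}$ and $\theta_\beta=\sqrt{M}/\beta^{3/2}$. Let $$X(t)=\begin{pmatrix} m_1x_1(t) & m_1y_1(t)\\ m_2x_2(t)& m_2y_2(t)\end{pmatrix},\qquad C_0=\dot X(0)X(0)^{-1},$$ let $\lambda_1,\lambda_2$ be the eigenvalues of $C_0$ (which are real), and let $\pi_s=\min\{\lambda_1,\lambda_2\}$. Let $T_s>0$ be the moment in time when the first syzygy occurs. Then $$\frac{1}{\theta_\alpha}\,\mathrm{arccot}\left(-\frac{\pi_s}{\theta_\alpha}\right)\le T_s\le\frac{1}{\theta_\beta}\,\mathrm{arccot}\left(-\frac{\pi_s}{\theta_\beta}\right).$$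
   Context: The Newtonian planar three-body problem with masses $m_1,m_2,m_3>0$ is the system for $z_k=x_k+iy_k\in\mathbb{C}$, $k=1,2,3$, $$\ddot z_1 = m_2\frac{z_{21}}{|z_{21}|^3}-m_3\frac{z_{13}}{|z_{13}|^3},\quad \ddot z_2 = m_3\frac{z_{32}}{|z_{32}|^3}-m_1\frac{z_{21}}{|z_{21}|^3},\quad \ddot z_3 = m_1\frac{z_{13}}{|z_{13}|^3}-m_2\frac{z_{32}}{|z_{32}|^3},$$ where $z_{kl}=z_k-z_l$. A solution is collision-free on an interval if $z_k(t)\neq z_l(t)$ for all $k\ne l$ and all $t$ in the interval. It is assumed throughout that $\sum_k m_k z_k=0$ and $\sum_k m_k\dot z_k=0$ (center of mass at the origin). The angular momentum is the conserved quantity $\sum_k m_k\,(x_k\dot y_k-y_k\dot x_k)$. The bodies form a syzygy at time $t_0$ if the three points $z_1(t_0),z_2(t_0),z_3(t_0)$ lie on a common real line in the plane; because the center of mass is at the origin, this is equivalent to $\det X(t_0)=0$, so $X(0)$ is invertible when the initial configuration is not a syzygy. In the zero angular momentum case both eigenvalues of $C_0$ are real. $T_s\in(0,a)$ denotes the first time at which a syzygy occurs (assumed to exist). The function $\mathrm{arccot}:\mathbb{R}\to(0,\pi)$ is the inverse of $\cot$ restricted to $(0,\pi)$. *)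

(* Defs.v *)
From HB Require Import structures.
From mathcomp Require Import all_boot all_order all_algebra.
From mathcomp Require Import all_classical all_reals all_analysis.
From mathcomp Require Import complex.

Set Implicit Arguments.
Unset Strict Implicit.
Unset Printing Implicit Defensive.

Import Order.TTheory GRing.Theory Num.Theory numFieldNormedType.Exports.

Local Open Scope classical_set_scope.
Local Open Scope ring_scope.
Local Open Scope complex_scope.

(* The interval [0, a), where a may be +oo. *)
Definition time_dom (R : realType) (a : \bar R) : set R :=
  [set t | 0 <= t /\ (t%:E < a)%E].

(* Limit of difference quotients along D: the ordinary derivative at interior
   points of D, the one-sided one at an endpoint. *)
Definition has_deriv_in (R : realType) (D : set R) (f : R -> R) (t l : R) :=
  (f s - f t) / (s - t) @[s --> within D t^'] --> l.

Definition has_cderiv_in (R : realType) (D : set R) (f : R -> R[i])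
    (t : R) (w : R[i]) :=
  has_deriv_in D (fun s => complex.Re (f s)) t (complex.Re w) /\
  has_deriv_in D (fun s => complex.Im (f s)) t (complex.Im w).

Notation cmod := ComplexField.Normc.normc (only parsing).

(* The bodies 1, 2, 3 are indexed by 0, 1, 2 : 'I_3. *)
Definition config (R : realType) := 'I_3 -> R[i].

(* Acceleration of body k. *)
Definition newton_field (R : realType) (m : 'I_3 -> R) (q : config R)
    (k : 'I_3) : R[i] :=
  \sum_(l < 3 | l != k) (m l)%:C * ((q l - q k) / (cmod (q l - q k) ^+ 3)%:C).

Definition collision_free (R : realType) (q : config R) :=
  forall k l, k != l -> q k != q l.

(* z t k and v t k are the position and the velocity of body k at time t. *)
Record three_body_solution (R : realType) (m : 'I_3 -> R) (D : set R)
    (z v : R -> config R) : Prop := {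
  sol_collision_free : forall t, D t -> collision_free (z t) ;
  sol_velocity : forall t k, D t ->
    has_cderiv_in D (fun s => z s k) t (v t k) ;
  sol_newton : forall t k, D t ->
    has_cderiv_in D (fun s => v s k) t (newton_field m (z t) k) ;
  sol_center : forall t, D t -> \sum_k (m k)%:C * z t k = 0 ;
  sol_momentum : forall t, D t -> \sum_k (m k)%:C * v t k = 0 }.

Definition angular_momentum (R : realType) (m : 'I_3 -> R) (q p : config R) : R :=
  \sum_k m k * (complex.Re (q k) * complex.Im (p k)
                - complex.Im (q k) * complex.Re (p k)).

(* The three points lie on the line through p directed by d. *)
Definition syzygy (R : realType) (q : config R) :=
  exists p d : R[i], d != 0 /\ forall k, exists s : R, q k = p + s%:C * d.

Definition first_syzygy_time (R : realType) (D : set R) (z : R -> config R)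
    (T : R) :=
  [/\ D T, 0 < T, syzygy (z T) &
      forall t, D t -> 0 < t -> t < T -> ~ syzygy (z t)].

(* The matrix ((m_1 x_1, m_1 y_1), (m_2 x_2, m_2 y_2)); applied to velocities it
   gives the time derivative of the matrix of positions. *)
Definition config_mx (R : realType) (m : 'I_3 -> R) (q : config R) : 'M[R]_2 :=
  \matrix_(i < 2, j < 2)
    (m (widen_ord (leqnSn 2) i) *
     (if j == 0 then complex.Re (q (widen_ord (leqnSn 2) i))
      else complex.Im (q (widen_ord (leqnSn 2) i)))).

(* l1 and l2 are the eigenvalues of A, repeated according to multiplicity. *)
Definition are_eigenvalues (F : fieldType) (A : 'M[F]_2) (l1 l2 : F) :=
  char_poly A = ('X - l1%:P) * ('X - l2%:P).

Definition theta (R : realType) (M r : R) : R := Num.sqrt M / r `^ (3 / 2).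

Definition cot (R : realType) (y : R) : R := cos y / sin y.

Definition arccot (R : realType) (x : R) : R :=
  get [set y | 0 < y < pi /\ cot y = x].

Lemma arccot_def (R : realType) (x : R) :
  0 < arccot x < pi /\ cot (arccot x) = x.
Proof.
rewrite /arccot; case: xgetP => //= H.
exfalso; apply: (H (pi / 2 - atan x)); split.
  have := atan_gtNpi2 x; have := atan_ltpi2 x => h1 h2.
  rewrite subr_gt0 h1 /= [ltRHS]splitr ltrD2l.
  by rewrite ltrNl.
rewrite /cot sinB cosB cos_pihalf sin_pihalf !mul0r !mul1r add0r subr0.
exact: atanK.
Qed.

(* Main.v *)
(* With w_i = m_i z_i (i = 1, 2), the equations of motion read X'' = - A X, where A is
   self-adjoint for the form G(u, v) = u1 v1/m1 + u2 v2/m2 + (u1 + u2)(v1 + v2)/m3 and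
   theta_beta^2 <= A <= theta_alpha^2.  Zero angular momentum means that C = X' X^-1 is
   self-adjoint for G.

   Upper bound: for a unit eigenvector e of C(0) with eigenvalue pi_s, the function
   phi = G(e, C e) satisfies phi' = - G(e, A e) - G(C e, C e) <= - theta_beta^2 - phi^2, so
   atan(phi / theta_beta) + theta_beta t is nonincreasing until the first syzygy.

   Lower bound: if X(Ts) k = 0 and u = X k, then r = G(u, u') / G(u, u) satisfies
   r' >= - theta_alpha^2 - r^2 and r(0) >= pi_s, so r would stay bounded below up to Ts if Ts
   were too small, and u(Ts) could not vanish. *)

Require Import Defs.
From HB Require Import structures.
From mathcomp Require Import all_boot all_order all_algebra.
From mathcomp Require Import all_classical all_reals all_analysis.
From mathcomp Require Import complex.
From mathcomp Require Import ring lra.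

Set Implicit Arguments.
Unset Strict Implicit.
Unset Printing Implicit Defensive.

Import Order.TTheory GRing.Theory Num.Theory numFieldNormedType.Exports.

Local Open Scope classical_set_scope.
Local Open Scope ring_scope.
Local Open Scope complex_scope.

(** * Arccotangent, monotonicity, and one-sided derivatives *)

Lemma arccotE (R : realType) (x : R) : arccot x = pi / 2 - atan x.
Proof.
have [/andP[y0 ypi] cy] := arccot_def x.
have xE : x = tan (pi / 2 - arccot x).
  by rewrite /tan sinB cosB cos_pihalf sin_pihalf !mul0r !mul1r add0r subr0.
by rewrite [in RHS]xE tanK; [lra|rewrite in_itv /=; apply/andP; split; lra].
Qed.

Lemma arccotN (R : realType) (x : R) : arccot (- x) = pi / 2 + atan x.
Proof. by rewrite arccotE atanN opprK. Qed.

Lemma is_derive1_ge0_le (R : realType) (f df : R -> R) (a b : R) : a <= b ->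
  (forall t, a <= t <= b -> is_derive t 1 f (df t)) ->
  (forall t, a < t < b -> 0 <= df t) -> f a <= f b.
Proof.
move=> ab fdf df_ge0; apply: (@ger0_derive1_le_cc _ f a b) => //.
- by move=> t; rewrite in_itv /= => /andP[/ltW ta /ltW tb];
    have [] := fdf t; rewrite ?ta.
- move=> t; rewrite in_itv /= => tab; rewrite derive1E.
  have [|_ ->] := fdf t; last exact: df_ge0.
  by case/andP: tab => /ltW-> /ltW->.
- apply: derivable_within_continuous => t; rewrite in_itv /= => tab.
  by have [] := fdf t.
- by rewrite in_itv /= lexx.
- by rewrite in_itv /= lexx andbT.
Qed.

(* The extension is linear on negative times, so that at time 0 the one-sided
   derivative becomes an ordinary one. *)
Lemma has_deriv_in_extension (R : realType) (a : \bar R) (f l : R -> R) :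
  (0 < a)%E ->
  (forall t, time_dom a t -> has_deriv_in (time_dom a) f t (l t)) ->
  exists2 g : R -> R, (forall t, 0 <= t -> g t = f t) &
    (forall t, time_dom a t -> is_derive t 1 g (l t)).
Proof.
move=> a_gt0 fl; pose g (s : R) : R := if s < 0 then f 0 + l 0 * s else f s.
have gE t : 0 <= t -> g t = f t by rewrite /g leNgt; case: ifP.
exists g => // t [t_ge0 ta]; apply/is_derive1_caratheodory.
exists (fun s => if s == t then l t else (g s - g t) / (s - t)); split.
- move=> s; case: eqVneq => [->|st]; first by rewrite !subrr mulr0.
  by rewrite divfK // subr_eq0.
- apply/cvgrPdist_lt => e e_gt0 /=; rewrite eqxx.
  have /cvgrPdist_lt/(_ e e_gt0) := fl t (conj t_ge0 ta).
  rewrite !near_withinE => Hnear.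
  have nearD : \forall s \near t, (s%:E < a)%E.
    case: a a_gt0 {fl Hnear} ta => [r| |] // _ => [|_]; last first.
      by near=> s; exact: ltry.
    by rewrite lte_fin => tr; near=> s; rewrite lte_fin; near: s; exact: lt_nbhsl.
  (* Negative [s] occur arbitrarily close to [t] only when [t = 0], and there the slope of the
     extension is exactly [l 0]. *)
  have near0 : \forall s \near t, 0 < t -> 0 < s.
    have [t_gt0|t_le0] := ltP 0 t; last by near=> s.
    by near=> s => _; near: s; exact: lt_nbhsr.
  near=> s; case: eqVneq => [_|st]; first by rewrite subrr normr0.
  have [s_lt0|s_ge0] := ltP s 0.
    have t0 : t = 0.
      apply/eqP; rewrite eq_le t_ge0 andbT leNgt; apply/negP => t_gt0.
      have : 0 < s by move: t_gt0; near: s.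
      by rewrite ltNge (ltW s_lt0).
    move: st; rewrite t0 (gE 0) // /g s_lt0 => s0.
    rewrite subr0 addrAC subrr add0r mulfK // subrr normr0 //.
  rewrite !gE //; suff: s != t -> time_dom a s -> `|l t - (f s - f t) / (s - t)| < e.
    by apply=> //; split => //; near: s.
  by near: s.
- by rewrite eqxx.
Unshelve. all: end_near. Qed.


(** * Scalar Riccati inequalities *)

(** The function is a first integral of the Riccati equation [f' = - (theta ^ 2 + f ^ 2)], so its
    derivative has the sign of the defect [theta ^ 2 + f ^ 2 + f']. *)
Lemma is_derive1_atan_riccati (R : realType) (theta t a : R) (f : R -> R) :
  0 < theta -> is_derive t 1 f a ->
  is_derive t 1 (fun s => atan (f s / theta) + theta * s)
    (theta * (theta ^+ 2 + f t ^+ 2 + a) / (theta ^+ 2 + f t ^+ 2)).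
Proof.
move=> theta_gt0 df; apply: is_derive_eq; rewrite /GRing.scale /=.
have den_gt0 : 0 < theta ^+ 2 + f t ^+ 2 by rewrite ltr_pwDl ?exprn_gt0 ?sqr_ge0.
by field; rewrite !gt_eqF.
Qed.

Lemma atan_riccati_le (R : realType) (theta T : R) (f df : R -> R) :
  0 < theta ->
  (forall t, 0 <= t < T -> is_derive t 1 f (df t)) ->
  (forall t, 0 <= t < T -> df t <= - (theta ^+ 2 + f t ^+ 2)) ->
  forall t, 0 <= t < T -> atan (f t / theta) + theta * t <= atan (f 0 / theta).
Proof.
move=> theta_gt0 fdf df_le t /andP[t_ge0 tT].
pose g s := - (atan (f s / theta) + theta * s).
suff : g 0 <= g t by rewrite /g mulr0 addr0 lerN2.
apply: (@is_derive1_ge0_le _ g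
  (fun s => - (theta * (theta ^+ 2 + f s ^+ 2 + df s) / (theta ^+ 2 + f s ^+ 2))))
  => [//|s|s] /andP[s0 st].
  by apply/is_deriveN/is_derive1_atan_riccati/fdf;
    rewrite // s0 (le_lt_trans st).
rewrite oppr_ge0 mulr_le0_ge0 ?invr_ge0 ?addr_ge0 ?sqr_ge0 //.
rewrite mulr_ge0_le0 ?(ltW theta_gt0) // -lerBrDl sub0r.
by rewrite df_le // ltW //= (lt_trans st).
Qed.

Lemma atan_riccati_ge (R : realType) (theta T : R) (f df : R -> R) :
  0 < theta ->
  (forall t, 0 <= t < T -> is_derive t 1 f (df t)) ->
  (forall t, 0 <= t < T -> - (theta ^+ 2 + f t ^+ 2) <= df t) ->
  forall t, 0 <= t < T -> atan (f 0 / theta) <= atan (f t / theta) + theta * t.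
Proof.
move=> theta_gt0 fdf df_ge t /andP[t_ge0 tT].
pose g s := atan (f s / theta) + theta * s.
suff : g 0 <= g t by rewrite /g mulr0 addr0.
apply: (@is_derive1_ge0_le _ g
  (fun s => theta * (theta ^+ 2 + f s ^+ 2 + df s) / (theta ^+ 2 + f s ^+ 2)))
  => [//|s|s] /andP[s0 st].
  by apply/is_derive1_atan_riccati/fdf; rewrite // s0 (le_lt_trans st).
rewrite divr_ge0 ?addr_ge0 ?sqr_ge0 ?mulr_ge0 ?(ltW theta_gt0) // -lerBlDl sub0r.
by rewrite df_ge // ltW //= (lt_trans st).
Qed.

(** The angle [atan (f / theta)] decreases at rate at least [theta] and has to stay above
    [- pi / 2], which bounds the lifetime of [f]. *)
Lemma riccati_upper_bound (R : realType) (theta T : R) (f df : R -> R) :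
  0 < theta ->
  (forall t, 0 <= t < T -> is_derive t 1 f (df t)) ->
  (forall t, 0 <= t < T -> df t <= - (theta ^+ 2 + f t ^+ 2)) ->
  T <= theta^-1 * (pi / 2 + atan (f 0 / theta)).
Proof.
move=> theta_gt0 fdf df_le; rewrite leNgt; apply/negP => lt_T.
(* [T0] is the time at which the line [atan (f 0 / theta) - theta * t] reaches [- pi / 2]; the
   comparison at [T0] contradicts the range of [atan]. *)
set T0 := theta^-1 * _ in lt_T.
have T0E : theta * T0 = pi / 2 + atan (f 0 / theta).
  by rewrite mulVKf ?gt_eqF.
have T0_gt0 : 0 < T0.
  rewrite -(ltr_pM2l theta_gt0) mulr0 T0E.
  by have := atan_gtNpi2 (f 0 / theta); lra.
have := atan_riccati_le theta_gt0 fdf df_le (t := T0).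
rewrite T0E (ltW T0_gt0) lt_T => /(_ isT).
by have := atan_gtNpi2 (f T0 / theta); lra.
Qed.

(* Here [N] is a squared norm [<u, u>] and [P] is [<u, u'>], so that [P / N] is
   half the logarithmic derivative of [N]. *)
Lemma riccati_lower_bound (R : realType) (theta c T : R) (N P Q S : R -> R) :
  0 < theta -> 0 < T ->
  (forall t, 0 <= t <= T -> is_derive t 1 N (2 * P t)) ->
  (forall t, 0 <= t <= T -> is_derive t 1 P (Q t - S t)) ->
  (forall t, 0 <= t <= T -> P t ^+ 2 <= N t * Q t) ->
  (forall t, 0 <= t <= T -> S t <= theta ^+ 2 * N t) ->
  (forall t, 0 <= t < T -> 0 < N t) -> N T = 0 -> c * N 0 <= P 0 ->
  theta^-1 * (pi / 2 + atan (c / theta)) <= T.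
Proof.
move=> theta_gt0 T_gt0 dN dP PNQ SN N_gt0 NT0 cP; rewrite leNgt; apply/negP => T_lt.
have {}T_lt : theta * T < pi / 2 + atan (c / theta).
  by move: T_lt; rewrite -(ltr_pM2l theta_gt0) mulVKf ?gt_eqF.
have co t : 0 <= t < T -> 0 <= t <= T by case/andP => -> /ltW.
pose r t := P t / N t.
have dr t : 0 <= t < T -> is_derive t 1 r ((Q t - S t) / N t - 2 * r t ^+ 2).
  move=> tT; have Nt := N_gt0 t tT; have dNt := dN t (co t tT).
  have dPt := dP t (co t tT).
  have dVt := is_deriveV (lt0r_neq0 Nt) dNt.
  by apply: is_derive_eq; rewrite /GRing.scale /= /r; field; rewrite gt_eqF.
(* The Cauchy-Schwarz hypothesis gives [r ^ 2 <= Q / N], which absorbs one of the two copies of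
   [r ^ 2]. *)
have dr_ge t : 0 <= t < T ->
    - (theta ^+ 2 + r t ^+ 2) <= (Q t - S t) / N t - 2 * r t ^+ 2.
  move=> tT; have Nt := N_gt0 t tT.
  have h1 : r t ^+ 2 <= Q t / N t.
    rewrite /r expr_div_n ler_pdivrMr ?exprn_gt0 //.
    have -> : Q t / N t * N t ^+ 2 = N t * Q t by field; rewrite gt_eqF.
    exact/PNQ/co.
  have h2 : S t / N t <= theta ^+ 2 by rewrite ler_pdivrMr // SN // co.
  by rewrite mulrBl; lra.
(* [k] is the value at time [T] of the Riccati solution starting from [c]. It is finite because the
   negated goal keeps the angle above [- pi / 2], and that solution decreases, so [k] bounds [r]
   from below on all of [[0, T)]. *)
pose k := theta * tan (atan (c / theta) - theta * T).
have T0 : 0 <= (0 : R) < T by rewrite lexx.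
have r_ge t : 0 <= t < T -> k <= r t.
  move=> tT; have := atan_riccati_ge theta_gt0 dr dr_ge tT.
  have : atan (c / theta) <= atan (r 0 / theta).
    apply: le_atan; rewrite ler_pM2r ?invr_gt0 // ler_pdivlMr //.
    exact: N_gt0.
  have : theta * t < theta * T by rewrite ltr_pM2l //; case/andP: tT.
  move=> h1 h2 h3; rewrite leNgt; apply/negP => rk.
  have /lt_atan : r t / theta < k / theta by rewrite ltr_pM2r ?invr_gt0.
  rewrite [k / _]mulrAC divff ?gt_eqF // mul1r tanK; first by move=> h4; lra.
  have := atan_ltpi2 (c / theta); have : 0 < theta * T by rewrite mulr_gt0.
  by rewrite in_itv /= => ? ?; apply/andP; split; lra.
(* From [N' = 2 r N >= 2 k N], the function [N] times [expR (- (2 * k * s))] is nondecreasing, so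
   [N] cannot reach zero at [T]. *)
have : N 0 * expR (- (2 * k * 0)) <= N T * expR (- (2 * k * T)).
  apply: (@is_derive1_ge0_le _ (fun s => N s * expR (- (2 * k * s)))
    (fun s => 2 * (P s - k * N s) * expR (- (2 * k * s)))) => [|s sT|s /andP[s0 sT]].
  - exact: ltW.
  - have dNs := dN s sT; apply: is_derive_eq.
    by rewrite /GRing.scale /=; ring.
  - have sI : 0 <= s < T by rewrite ltW.
    rewrite !mulr_ge0 ?expR_ge0 // subr_ge0 -ler_pdivlMr ?N_gt0 //.
    exact: r_ge.
by rewrite NT0 mul0r mulr0 oppr0 expR0 mulr1 leNgt N_gt0.
Qed.

(** * Positive definite forms on the plane and self-adjoint operators *)

(** The symmetric bilinear form with Gram matrix [((g11, g12), (g12, g22))], written in scalars so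
    that its identities are polynomial. *)
Definition gform (R : realType) (g11 g12 g22 u1 u2 v1 v2 : R) : R :=
  g11 * u1 * v1 + g12 * (u1 * v2 + u2 * v1) + g22 * u2 * v2.

Lemma gform_gt0 (R : realType) (g11 g12 g22 u1 u2 : R) :
  0 < g11 -> g12 ^+ 2 < g11 * g22 -> (u1 != 0) || (u2 != 0) ->
  0 < gform g11 g12 g22 u1 u2 u1 u2.
Proof.
move=> g11_gt0; rewrite -subr_gt0 => det_gt0 u_neq0; rewrite -(pmulr_rgt0 _ g11_gt0).
have -> : g11 * gform g11 g12 g22 u1 u2 u1 u2 =
    (g11 * u1 + g12 * u2) ^+ 2 + (g11 * g22 - g12 ^+ 2) * u2 ^+ 2.
  by rewrite /gform; ring.
have [u2_0|u2_neq0] := eqVneq u2 0.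
  move: u_neq0; rewrite u2_0 eqxx orbF => u1_neq0.
  rewrite mulr0 addr0 expr0n /= mulr0 addr0 exprMn.
  by rewrite mulr_gt0 ?(exprn_gt0 _ g11_gt0) // exprn_even_gt0.
by rewrite ltr_wpDl ?sqr_ge0 // mulr_gt0 // exprn_even_gt0.
Qed.

(** Lagrange's identity: the gap is the Gram determinant times the square of [u1 * v2 - u2 * v1]. *)
Lemma gform_CauchySchwarz (R : realType) (g11 g12 g22 u1 u2 v1 v2 : R) :
  g12 ^+ 2 < g11 * g22 ->
  gform g11 g12 g22 u1 u2 v1 v2 ^+ 2 <=
    gform g11 g12 g22 u1 u2 u1 u2 * gform g11 g12 g22 v1 v2 v1 v2.
Proof.
rewrite -subr_gt0 => /ltW det_ge0; rewrite -subr_ge0 /gform.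
set X := (X in 0 <= X).
have -> : X = (g11 * g22 - g12 ^+ 2) * (u1 * v2 - u2 * v1) ^+ 2 by rewrite /X; ring.
by rewrite mulr_ge0 // sqr_ge0.
Qed.

(* [B := C - l1] satisfies [B ^ 2 = (l2 - l1) B] by Cayley-Hamilton, hence
   [<B u, B u> = (l2 - l1) <u, B u>] when [C] is self-adjoint. *)
Lemma gform_min_eigenvalue (R : realType)
    (g11 g12 g22 c11 c12 c21 c22 l1 l2 u1 u2 : R) :
  0 < g11 -> g12 ^+ 2 < g11 * g22 ->
  g11 * c12 + g12 * c22 = g12 * c11 + g22 * c21 ->
  c11 + c22 = l1 + l2 -> c11 * c22 - c12 * c21 = l1 * l2 -> l1 <= l2 ->
  l1 * gform g11 g12 g22 u1 u2 u1 u2 <=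
    gform g11 g12 g22 u1 u2 (c11 * u1 + c12 * u2) (c21 * u1 + c22 * u2).
Proof.
move=> g11_gt0 det_gt0 sym tr det; rewrite -subr_ge0 le_eqVlt => l12.
pose w1 := (c11 - l1) * u1 + c12 * u2; pose w2 := c21 * u1 + (c22 - l1) * u2.
rewrite -subr_ge0; set X := (X in 0 <= X).
have -> : X = gform g11 g12 g22 u1 u2 w1 w2 by rewrite /X /gform /w1 /w2; ring.
have ww : gform g11 g12 g22 w1 w2 w1 w2 = (l2 - l1) * gform g11 g12 g22 u1 u2 w1 w2.
  have detB : (c11 - l1) * (c22 - l1) - c12 * c21 = 0.
    have -> : (c11 - l1) * (c22 - l1) - c12 * c21 =
      (c11 * c22 - c12 * c21) - l1 * (c11 + c22) + l1 * l1 by ring.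
    by rewrite tr det; ring.
  have -> : l2 = c11 + c22 - l1 by rewrite tr; ring.
  have k0 : g11 * c12 + g12 * c22 - (g12 * c11 + g22 * c21) = 0.
    by rewrite sym subrr.
  (* Here [k0] is the defect of self-adjointness and [detB] states that [B] is singular; adding
     suitable multiples of both turns the claim into a polynomial identity. *)
  rewrite -[RHS]addr0 -[in RHS](mulr0 (u2 * w1 - u1 * w2)) -k0.
  rewrite -[RHS]subr0 -[in RHS](mulr0 (gform g11 g12 g22 u1 u2 u1 u2)) -detB.
  by rewrite /gform /w1 /w2; ring.
(* If [w = B u] is nonzero, then [<w, w> > 0] excludes [l1 = l2], and dividing by [l2 - l1] gives
   [<u, w> > 0]. *)
have [/andP[/eqP w10 /eqP w20]|] := boolP ((w1 == 0) && (w2 == 0)).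
  by rewrite /gform w10 w20 !mulr0 !addr0 mulr0.
rewrite negb_and => /(gform_gt0 g11_gt0 det_gt0); rewrite ww.
case/predU1P: l12 => [<-|l12]; first by rewrite mul0r ltxx.
by rewrite pmulr_rgt0 // => /ltW.
Qed.

(** The vector [(c12, l - c11)] is killed by the first row of [C - l], hence by the second since the
    determinant vanishes; [(l - c22, c21)] works symmetrically. If both vanish, [C] is the scalar
    [l] and any nonzero vector serves. *)
Lemma eigenvector2 (R : realType) (c11 c12 c21 c22 l : R) :
  (c11 - l) * (c22 - l) = c12 * c21 ->
  exists e1 e2, [/\ (e1 != 0) || (e2 != 0),
    c11 * e1 + c12 * e2 = l * e1 & c21 * e1 + c22 * e2 = l * e2].
Proof.
move=> det0.
have [/andP[/eqP c12_0 /eqP c11l]|] := boolP ((c12 == 0) && (l - c11 == 0)); last first.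
  rewrite negb_and => e_neq0; exists c12, (l - c11); split=> //; first by ring.
  by rewrite mulrC -det0; ring.
have [/andP[/eqP c22l /eqP c21_0]|] := boolP ((l - c22 == 0) && (c21 == 0)); last first.
  rewrite negb_and => e_neq0; exists (l - c22), c21; split=> //; last by ring.
  by rewrite -det0; ring.
exists 1, 0; split; rewrite ?oner_eq0 // !mulr0 addr0 ?c21_0 ?mul0r //.
by rewrite (subr0_eq c11l).
Qed.

(** This makes the eigenvalues of a self-adjoint [C] real. Multiplied by [g11 * g22], the
    discriminant is a sum of two nonnegative terms plus a product, one factor of which vanishes by
    self-adjointness. *)
Lemma symmetric_discriminant_ge0 (R : realType) (g11 g12 g22 c11 c12 c21 c22 : R) :
  0 < g11 -> g12 ^+ 2 < g11 * g22 ->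
  g11 * c12 + g12 * c22 = g12 * c11 + g22 * c21 ->
  4 * (c11 * c22 - c12 * c21) <= (c11 + c22) ^+ 2.
Proof.
move=> g11_gt0 det_gt0 sym.
have gg_gt0 : 0 < g11 * g22 by rewrite (le_lt_trans (sqr_ge0 g12)).
rewrite -subr_ge0 -(pmulr_rge0 _ gg_gt0).
set X := (X in 0 <= X).
have -> : X = (g11 * g22 - g12 ^+ 2) * (c11 - c22) ^+ 2 +
    (g11 * c12 + g22 * c21) ^+ 2 +
    (g12 * (c11 - c22) - (g11 * c12 - g22 * c21)) *
    (g12 * (c11 - c22) + (g11 * c12 - g22 * c21)) by rewrite /X; ring.
have -> : g12 * (c11 - c22) - (g11 * c12 - g22 * c21) = 0.
  have -> : g11 * c12 = g12 * c11 + g22 * c21 - g12 * c22 by rewrite -sym; ring.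
  by ring.
by rewrite mul0r addr0 addr_ge0 ?sqr_ge0 // mulr_ge0 ?sqr_ge0 // subr_ge0 ltW.
Qed.

(** * Linear second-order motions [X'' = - A X] *)

(* Riccati equation [C' = - A - C ^ 2] for one row of [C = X' X^-1], where the
   rows of [X] are [(x1, y1)] and [(x2, y2)] and [(p, q)] is a row of [X']. *)
Lemma is_derive_riccati_row (R : realType) (x1 y1 x2 y2 p1 q1 p2 q2 p q : R -> R)
    (a1 a2 t : R) :
  let d t := x1 t * y2 t - x2 t * y1 t in
  d t != 0 ->
  is_derive t 1 x1 (p1 t) -> is_derive t 1 y1 (q1 t) ->
  is_derive t 1 x2 (p2 t) -> is_derive t 1 y2 (q2 t) ->
  is_derive t 1 p (- (a1 * x1 t + a2 * x2 t)) ->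
  is_derive t 1 q (- (a1 * y1 t + a2 * y2 t)) ->
  let c1 t := (p t * y2 t - q t * x2 t) / d t in
  let c2 t := (q t * x1 t - p t * y1 t) / d t in
  let c11 t := (p1 t * y2 t - q1 t * x2 t) / d t in
  let c12 t := (q1 t * x1 t - p1 t * y1 t) / d t in
  let c21 t := (p2 t * y2 t - q2 t * x2 t) / d t in
  let c22 t := (q2 t * x1 t - p2 t * y1 t) / d t in
  is_derive t 1 c1 (- a1 - (c1 t * c11 t + c2 t * c21 t)) /\
  is_derive t 1 c2 (- a2 - (c1 t * c12 t + c2 t * c22 t)).
Proof.
move=> d dt dx1 dy1 dx2 dy2 dp dq c1 c2 c11 c12 c21 c22.
have dd : is_derive t 1 d (p1 t * y2 t + x1 t * q2 t - (p2 t * y1 t + x2 t * q1 t)).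
  by apply: is_derive_eq; rewrite /GRing.scale /=; ring.
have dVd := is_deriveV dt dd.
split; apply: is_derive_eq; rewrite /GRing.scale /= /c1 /c2 /c11 /c12 /c21 /c22;
  by rewrite /d; field.
Qed.

(** For the fixed vector [e], the Rayleigh quotient [f = G(e, C e) / G(e, e)] starts at [l],
    satisfies a Riccati inequality, and exists as long as [X] is invertible. *)
Lemma linear_motion_upper_bound (R : realType) (g11 g12 g22 theta T l e1 e2 : R)
    (x1 y1 x2 y2 p1 q1 p2 q2 a11 a12 a21 a22 : R -> R) :
  let d t := x1 t * y2 t - x2 t * y1 t in
  let c11 t := (p1 t * y2 t - q1 t * x2 t) / d t in
  let c12 t := (q1 t * x1 t - p1 t * y1 t) / d t in
  let c21 t := (p2 t * y2 t - q2 t * x2 t) / d t in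
  let c22 t := (q2 t * x1 t - p2 t * y1 t) / d t in
  0 < g11 -> g12 ^+ 2 < g11 * g22 -> 0 < theta ->
  (forall t, 0 <= t < T -> d t != 0) ->
  (forall t, 0 <= t < T ->
    [/\ is_derive t 1 x1 (p1 t), is_derive t 1 y1 (q1 t),
        is_derive t 1 x2 (p2 t) & is_derive t 1 y2 (q2 t)]) ->
  (forall t, 0 <= t < T ->
    [/\ is_derive t 1 p1 (- (a11 t * x1 t + a12 t * x2 t)),
        is_derive t 1 q1 (- (a11 t * y1 t + a12 t * y2 t)),
        is_derive t 1 p2 (- (a21 t * x1 t + a22 t * x2 t)) &
        is_derive t 1 q2 (- (a21 t * y1 t + a22 t * y2 t))]) ->
  (forall t, 0 <= t < T ->
    g11 * c12 t + g12 * c22 t = g12 * c11 t + g22 * c21 t) ->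
  (forall t u1 u2, 0 <= t < T -> theta ^+ 2 * gform g11 g12 g22 u1 u2 u1 u2 <=
    gform g11 g12 g22 u1 u2 (a11 t * u1 + a12 t * u2) (a21 t * u1 + a22 t * u2)) ->
  (e1 != 0) || (e2 != 0) ->
  c11 0 * e1 + c12 0 * e2 = l * e1 -> c21 0 * e1 + c22 0 * e2 = l * e2 ->
  T <= theta^-1 * (pi / 2 + atan (l / theta)).
Proof.
move=> d c11 c12 c21 c22 g11_gt0 det_gt0 theta_gt0 d0 dX dP sym A_ge e_neq0 Ce1 Ce2.
have dC t : 0 <= t < T ->
    [/\ is_derive t 1 c11 (- a11 t - (c11 t * c11 t + c12 t * c21 t)),
        is_derive t 1 c12 (- a12 t - (c11 t * c12 t + c12 t * c22 t)),
        is_derive t 1 c21 (- a21 t - (c21 t * c11 t + c22 t * c21 t)) &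
        is_derive t 1 c22 (- a22 t - (c21 t * c12 t + c22 t * c22 t))].
  move=> tT; have [dx1 dy1 dx2 dy2] := dX t tT; have [dp1 dq1 dp2 dq2] := dP t tT.
  have [? ?] := is_derive_riccati_row (d0 t tT) dx1 dy1 dx2 dy2 dp1 dq1.
  have [? ?] := is_derive_riccati_row (d0 t tT) dx1 dy1 dx2 dy2 dp2 dq2.
  by split.
clearbody c11 c12 c21 c22.
pose w1 t := c11 t * e1 + c12 t * e2; pose w2 t := c21 t * e1 + c22 t * e2.
have := gform_gt0 g11_gt0 det_gt0 e_neq0.
set n := gform g11 g12 g22 e1 e2 e1 e2.
have nE : n = gform g11 g12 g22 e1 e2 e1 e2 by [].
clearbody n => n_gt0.
pose f t := gform g11 g12 g22 e1 e2 (w1 t) (w2 t) / n.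
pose df t := - (gform g11 g12 g22 e1 e2 (a11 t * e1 + a12 t * e2)
    (a21 t * e1 + a22 t * e2) + gform g11 g12 g22 (w1 t) (w2 t) (w1 t) (w2 t)) / n.
have -> : l = f 0.
  rewrite /f /w1 /w2 Ce1 Ce2 -[LHS](mulfK (lt0r_neq0 n_gt0)) {1}nE.
  by congr (_ / _); rewrite /gform; ring.
apply: (@riccati_upper_bound _ _ _ f df) => // t tT.
- have [dc11 dc12 dc21 dc22] := dC t tT.
  rewrite /f /w1 /w2 /gform; apply: is_derive_eq; rewrite /GRing.scale /=.
  have skew0 : g11 * c12 t + g12 * c22 t - (g12 * c11 t + g22 * c21 t) = 0.
    by rewrite sym // subrr.
  (* Self-adjointness of [C] turns the term [G(e, C (C e))] of the Riccati equation into
     [G(C e, C e)]. *)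
  have ww : gform g11 g12 g22 (w1 t) (w2 t) (w1 t) (w2 t) =
      gform g11 g12 g22 e1 e2 (c11 t * w1 t + c12 t * w2 t)
        (c21 t * w1 t + c22 t * w2 t).
    rewrite -[RHS]addr0 -[in RHS](mulr0 (e2 * w1 t - e1 * w2 t)) -skew0.
    by rewrite /gform /w1 /w2; ring.
  rewrite /df ww /gform /w1 /w2.
  by field; rewrite gt_eqF.
- rewrite /df mulNr lerN2 ler_pdivlMr // mulrDl lerD //; first by rewrite nE A_ge.
  rewrite /f expr_div_n.
  have -> : gform g11 g12 g22 e1 e2 (w1 t) (w2 t) ^+ 2 / n ^+ 2 * n =
    gform g11 g12 g22 e1 e2 (w1 t) (w2 t) ^+ 2 / n by field; rewrite gt_eqF.
  by rewrite ler_pdivrMr // mulrC nE gform_CauchySchwarz.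
Qed.

(** A kernel vector [(a, b)] of the singular matrix [X(T)] yields a motion [u = X (a, b)] that
    vanishes at [T] but not before. Its squared norm is then subject to [riccati_lower_bound]. *)
Lemma linear_motion_lower_bound (R : realType) (g11 g12 g22 theta T l : R)
    (x1 y1 x2 y2 p1 q1 p2 q2 a11 a12 a21 a22 : R -> R) :
  let d t := x1 t * y2 t - x2 t * y1 t in
  let c11 t := (p1 t * y2 t - q1 t * x2 t) / d t in
  let c12 t := (q1 t * x1 t - p1 t * y1 t) / d t in
  let c21 t := (p2 t * y2 t - q2 t * x2 t) / d t in
  let c22 t := (q2 t * x1 t - p2 t * y1 t) / d t in
  0 < g11 -> g12 ^+ 2 < g11 * g22 -> 0 < theta -> 0 < T ->
  (forall t, 0 <= t < T -> d t != 0) -> d T = 0 ->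
  (forall t, 0 <= t <= T ->
    [/\ is_derive t 1 x1 (p1 t), is_derive t 1 y1 (q1 t),
        is_derive t 1 x2 (p2 t) & is_derive t 1 y2 (q2 t)]) ->
  (forall t, 0 <= t <= T ->
    [/\ is_derive t 1 p1 (- (a11 t * x1 t + a12 t * x2 t)),
        is_derive t 1 q1 (- (a11 t * y1 t + a12 t * y2 t)),
        is_derive t 1 p2 (- (a21 t * x1 t + a22 t * x2 t)) &
        is_derive t 1 q2 (- (a21 t * y1 t + a22 t * y2 t))]) ->
  (forall t u1 u2, 0 <= t <= T ->
    gform g11 g12 g22 u1 u2 (a11 t * u1 + a12 t * u2) (a21 t * u1 + a22 t * u2) <=
    theta ^+ 2 * gform g11 g12 g22 u1 u2 u1 u2) ->
  (forall u1 u2, l * gform g11 g12 g22 u1 u2 u1 u2 <=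
    gform g11 g12 g22 u1 u2 (c11 0 * u1 + c12 0 * u2) (c21 0 * u1 + c22 0 * u2)) ->
  theta^-1 * (pi / 2 + atan (l / theta)) <= T.
Proof.
move=> d c11 c12 c21 c22 g11_gt0 det_gt0 theta_gt0 T_gt0 d0 dT dX dP A_le C_ge.
(* The kernel vector is an eigenvector of [X(T)] for the eigenvalue 0. *)
have [a [b [ab_neq0 xT yT]]] : exists a b, [/\ (a != 0) || (b != 0),
    x1 T * a + y1 T * b = 0 * a & x2 T * a + y2 T * b = 0 * b].
  apply: eigenvector2; rewrite !subr0 [RHS]mulrC; apply/eqP.
  by rewrite -subr_eq0; apply/eqP.
rewrite !mul0r in xT yT.
pose u1 t := x1 t * a + y1 t * b; pose u2 t := x2 t * a + y2 t * b.
pose v1 t := p1 t * a + q1 t * b; pose v2 t := p2 t * a + q2 t * b.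
have du t : 0 <= t <= T -> is_derive t 1 u1 (v1 t) /\ is_derive t 1 u2 (v2 t).
  move=> tT; have [dx1 dy1 dx2 dy2] := dX t tT.
  by split; apply: is_derive_eq; rewrite /GRing.scale /= /v1 /v2; ring.
have dv t : 0 <= t <= T -> is_derive t 1 v1 (- (a11 t * u1 t + a12 t * u2 t)) /\
    is_derive t 1 v2 (- (a21 t * u1 t + a22 t * u2 t)).
  move=> tT; have [dp1 dq1 dp2 dq2] := dP t tT.
  by split; apply: is_derive_eq; rewrite /GRing.scale /= /u1 /u2; ring.
have u_neq0 t : 0 <= t < T -> (u1 t != 0) || (u2 t != 0).
  move=> /d0; apply: contraNT; rewrite negb_or !negbK => /andP[/eqP u1_0 /eqP u2_0].
  (* Cramer's rule recovers [d t * a] and [d t * b] from [u]. *)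
  have da : d t * a = 0.
    have -> : d t * a = y2 t * u1 t - y1 t * u2 t by rewrite /d /u1 /u2; ring.
    by rewrite u1_0 u2_0 !mulr0 subr0.
  have db : d t * b = 0.
    have -> : d t * b = x1 t * u2 t - x2 t * u1 t by rewrite /d /u1 /u2; ring.
    by rewrite u1_0 u2_0 !mulr0 subr0.
  move/eqP: da; move/eqP: db; rewrite !mulf_eq0; case: (d t == 0) => //= b0 a0.
  by move: ab_neq0; rewrite a0 b0.
have T0 : 0 <= (0 : R) < T by rewrite lexx.
apply: (@riccati_lower_bound _ theta l T
  (fun t => gform g11 g12 g22 (u1 t) (u2 t) (u1 t) (u2 t))
  (fun t => gform g11 g12 g22 (u1 t) (u2 t) (v1 t) (v2 t))
  (fun t => gform g11 g12 g22 (v1 t) (v2 t) (v1 t) (v2 t))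
  (fun t => gform g11 g12 g22 (u1 t) (u2 t)
    (a11 t * u1 t + a12 t * u2 t) (a21 t * u1 t + a22 t * u2 t))) => //.
- move=> t tT; have [du1 du2] := du t tT.
  by rewrite /gform; apply: is_derive_eq; rewrite /GRing.scale /=; ring.
- move=> t tT; have [du1 du2] := du t tT; have [dv1 dv2] := dv t tT.
  by rewrite /gform; apply: is_derive_eq; rewrite /GRing.scale /=; ring.
- by move=> t _; exact: gform_CauchySchwarz.
- by move=> t tT; exact: A_le.
- by move=> t tT; apply: gform_gt0 => //; exact: u_neq0.
- by rewrite /gform /u1 /u2 xT yT; ring.
(* Since [X' = C X], the initial velocity is [C(0) u(0)], and the lower bound on [C(0)] applies to
   [u(0)]. *)
- have -> : v1 0 = c11 0 * u1 0 + c12 0 * u2 0.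
    have := d0 0 T0; rewrite /v1 /c11 /c12 /u1 /u2 /d => ?; field; assumption.
  have -> : v2 0 = c21 0 * u1 0 + c22 0 * u2 0.
    have := d0 0 T0; rewrite /v2 /c21 /c22 /u1 /u2 /d => ?; field; assumption.
  exact: C_ge.
Qed.

(** * Sums over three bodies, two-by-two matrices and their eigenvalues *)

Lemma big_ord3 (V : nmodType) (F : 'I_3 -> V) :
  \sum_k F k = F (@Ordinal 3 0 isT) + F (@Ordinal 3 1 isT) + F (@Ordinal 3 2 isT).
Proof.
rewrite !big_ord_recr big_ord0 /= add0r.
by congr (F _ + F _ + F _); exact: val_inj.
Qed.

Lemma ord3P (P : 'I_3 -> Prop) :
  P (@Ordinal 3 0 isT) -> P (@Ordinal 3 1 isT) -> P (@Ordinal 3 2 isT) ->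
  forall k, P k.
Proof.
move=> P0 P1 P2 [[|[|[|//]]] k3].
- by rewrite (_ : Ordinal k3 = @Ordinal 3 0 isT) //; exact: val_inj.
- by rewrite (_ : Ordinal k3 = @Ordinal 3 1 isT) //; exact: val_inj.
- by rewrite (_ : Ordinal k3 = @Ordinal 3 2 isT) //; exact: val_inj.
Qed.

Lemma det_mx22 (R : comNzRingType) (A : 'M[R]_2) :
  \det A = A 0 0 * A 1 1 - A 0 1 * A 1 0.
Proof.
rewrite (expand_det_row _ 0) !big_ord_recl big_ord0 /cofactor !det_mx11 !mxE /=.
rewrite addr0 expr0 mul1r expr1 mulN1r mulrN.
by congr (A _ _ * A _ _ - A _ _ * A _ _); exact: val_inj.
Qed.

Lemma mxtrace22 (R : comNzRingType) (A : 'M[R]_2) : \tr A = A 0 0 + A 1 1.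
Proof.
rewrite /mxtrace !big_ord_recl big_ord0 addr0.
by congr (A _ _ + A _ _); exact: val_inj.
Qed.

Lemma are_eigenvaluesE (F : fieldType) (A : 'M[F]_2) (l1 l2 : F) :
  are_eigenvalues A l1 l2 -> l1 + l2 = \tr A /\ l1 * l2 = \det A.
Proof.
move=> eigA; have := char_poly_trace A isT; have := char_poly_det A.
rewrite eigA sqrrN expr1n mul1r => <-.
have -> : ('X - l1%:P) * ('X - l2%:P) = 'X^2 - (l1 + l2)%:P * 'X + (l1 * l2)%:P.
  by rewrite polyCD polyCM; ring.
rewrite !coefD !coefN !coefCM !coefX !coefXn !coefC /= !mulr0 !mulr1 !add0r.
by rewrite oppr0 addr0 add0r => /oppr_inj ->.
Qed.

(** The sum and product of [l1] and [l2] are real. A nonzero imaginary part would make them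
    conjugate with equal real parts, and the discriminant would be negative. *)
Lemma real_eigenvalues (R : realType) (C : 'M[R]_2) (l1 l2 : R[i]) :
  are_eigenvalues (map_mx (real_complex R) C) l1 l2 ->
  4 * \det C <= (\tr C) ^+ 2 ->
  [/\ complex.Im l1 = 0, complex.Im l2 = 0,
      complex.Re l1 + complex.Re l2 = \tr C &
      complex.Re l1 * complex.Re l2 = \det C].
Proof.
case/are_eigenvaluesE; rewrite det_map_mx trace_map_mx.
case: l1 l2 => [a1 b1] [a2 b2] /= [trE im_tr] [detE im_det] disc.
have b2E : b2 = - b1 by apply/eqP; rewrite -addr_eq0 addrC im_tr.
rewrite b2E in detE im_det *.
have b1_0 : b1 = 0.
  have h : b1 * (a2 - a1) = 0 by rewrite -im_det; ring.
  apply/eqP; rewrite -sqrf_eq0 eq_le sqr_ge0 andbT; move/eqP: h.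
  rewrite mulf_eq0 => /orP[/eqP->|]; first by rewrite expr0n.
  rewrite subr_eq0 => /eqP a21; move: disc; rewrite -trE -detE a21; nra.
by rewrite b1_0 oppr0 in detE *; split=> //; rewrite -detE; ring.
Qed.

Lemma mulmx_invmx22 (F : fieldType) (V X : 'M[F]_2) (i : 'I_2) : \det X != 0 ->
  (V *m invmx X) i 0 = (V i 0 * X 1 1 - V i 1 * X 1 0) / \det X /\
  (V *m invmx X) i 1 = (V i 1 * X 0 0 - V i 0 * X 0 1) / \det X.
Proof.
move=> detX0; have uX : X \in unitmx by rewrite unitmxE unitfE.
have VE j : V i j = (V *m invmx X) i 0 * X 0 j + (V *m invmx X) i 1 * X 1 j.
  rewrite -{1}[V](mulmxKV uX) mxE !big_ord_recl big_ord0 addr0.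
  by congr (_ i _ * X _ j + _ i _ * X _ j); exact: val_inj.
rewrite (VE 0) (VE 1); move: detX0; rewrite det_mx22.
move: ((V *m invmx X) i 0) ((V *m invmx X) i 1) => c0 c1 detX0.
by split; field.
Qed.

(** * Components of the Newtonian field, and syzygy as a vanishing determinant *)

Lemma ReM_real (R : realType) (a : R) (w : R[i]) :
  complex.Re (a%:C * w) = a * complex.Re w.
Proof. by case: w => x y /=; rewrite mul0r subr0. Qed.

Lemma ImM_real (R : realType) (a : R) (w : R[i]) :
  complex.Im (a%:C * w) = a * complex.Im w.
Proof. by case: w => x y /=; rewrite mul0r addr0. Qed.

Lemma cmodC (R : realType) (w1 w2 : R[i]) : cmod (w1 - w2) = cmod (w2 - w1).
Proof.
by case: w1 w2 => x1 y1 [x2 y2] /=; congr Num.sqrt; ring.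
Qed.

Lemma Re_newton_field (R : realType) (m : 'I_3 -> R) (q : config R) (k : 'I_3) :
  complex.Re (newton_field m q k) =
  \sum_(l < 3 | l != k)
    m l * ((complex.Re (q l) - complex.Re (q k)) / cmod (q l - q k) ^+ 3).
Proof.
rewrite raddf_sum; apply: eq_bigr => l _; rewrite /= ReM_real; congr (_ * _).
by rewrite -fmorphV mulrC ReM_real raddfB mulrC.
Qed.

Lemma Im_newton_field (R : realType) (m : 'I_3 -> R) (q : config R) (k : 'I_3) :
  complex.Im (newton_field m q k) =
  \sum_(l < 3 | l != k)
    m l * ((complex.Im (q l) - complex.Im (q k)) / cmod (q l - q k) ^+ 3).
Proof.
rewrite raddf_sum; apply: eq_bigr => l _; rewrite /= ImM_real; congr (_ * _).
by rewrite -fmorphV mulrC ImM_real raddfB mulrC.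
Qed.

Lemma Re_centered (R : realType) (m : 'I_3 -> R) (q : config R) :
  \sum_k (m k)%:C * q k = 0 -> \sum_k m k * complex.Re (q k) = 0.
Proof.
move=> qc; transitivity (complex.Re (\sum_k (m k)%:C * q k)); last by rewrite qc.
by rewrite raddf_sum; apply: eq_bigr => k _; rewrite /= ReM_real.
Qed.

Lemma Im_centered (R : realType) (m : 'I_3 -> R) (q : config R) :
  \sum_k (m k)%:C * q k = 0 -> \sum_k m k * complex.Im (q k) = 0.
Proof.
move=> qc; transitivity (complex.Im (\sum_k (m k)%:C * q k)); last by rewrite qc.
by rewrite raddf_sum; apply: eq_bigr => k _; rewrite /= ImM_real.
Qed.

Definition cross (R : realType) (w1 w2 : R[i]) : R :=
  complex.Re w1 * complex.Im w2 - complex.Im w1 * complex.Re w2.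

Lemma det_config_mx (R : realType) (m : 'I_3 -> R) (q : config R) :
  let k0 := @Ordinal 3 0 isT in let k1 := @Ordinal 3 1 isT in
  \det (config_mx m q) = m k0 * m k1 * cross (q k0) (q k1).
Proof.
move=> k0 k1; rewrite det_mx22 !mxE /= /cross.
have -> : widen_ord (leqnSn 2) 0 = k0 by exact: val_inj.
have -> : widen_ord (leqnSn 2) 1 = k1 by exact: val_inj.
ring.
Qed.

Lemma cross_syzygy (R : realType) (q : config R) (d : R[i]) :
  d != 0 -> (forall k, cross d (q k) = 0) -> syzygy q.
Proof.
move=> d_neq0 dq; exists 0, d; split=> // k; have := dq k.
case: d d_neq0 {dq} => dx dy; case: (q k) => x y; rewrite eq_complex /= negb_and /cross /=.
move=> d_neq0 /eqP; rewrite subr_eq0 => /eqP dq.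
have n_neq0 : dx ^+ 2 + dy ^+ 2 != 0.
  by rewrite paddr_eq0 ?sqr_ge0 // !sqrf_eq0 negb_and.
(* The coefficient of the orthogonal projection of [q k] onto [d]. *)
exists ((dx * x + dy * y) / (dx ^+ 2 + dy ^+ 2)).
apply/eqP; rewrite add0r eq_complex /= !mul0r subr0 addr0; apply/andP; split; apply/eqP.
  transitivity ((dx * (dx * x) + dy * (dy * x)) / (dx ^+ 2 + dy ^+ 2)); first by field.
  by rewrite -dq; field.
transitivity ((dx * (dx * y) + dy * (dy * y)) / (dx ^+ 2 + dy ^+ 2)); first by field.
by rewrite dq; field.
Qed.

(** A line containing the three bodies contains their center of mass, hence passes through the
    origin. Conversely, if the first two positions are parallel, centering makes the third a
    combination of them. *)
Lemma syzygy_det0 (R : realType) (m : 'I_3 -> R) (q : config R) :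
  (forall k, 0 < m k) -> \sum_k (m k)%:C * q k = 0 ->
  syzygy q <-> \det (config_mx m q) = 0.
Proof.
move=> m_gt0 qc; rewrite det_config_mx.
set k0 := @Ordinal 3 0 isT; set k1 := @Ordinal 3 1 isT; set k2 := @Ordinal 3 2 isT.
have qcx := Re_centered qc; have qcy := Im_centered qc.
rewrite !big_ord3 -/k0 -/k1 -/k2 in qcx qcy.
split.
  case=> p [d [_ qE]].
  have [[s0 q0] [s1 q1] [s2 q2]] := And3 (qE k0) (qE k1) (qE k2).
  move: qcx qcy; rewrite q0 q1 q2 /cross.
  case: p d {qE q0 q1 q2} => px py [dx dy] /=; rewrite !mul0r !subr0 !addr0.
  set X := (X in X = 0 -> _) => hx; set Y := (X in X = 0 -> _) => hy.
  have M_neq0 : m k0 + m k1 + m k2 != 0 by rewrite gt_eqF // !addr_gt0.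
  (* Crossing the center of mass relation with [d] removes the parameters along the line and leaves
     the total mass times the cross product of [p] and [d]. *)
  have pd0 : px * dy - py * dx = 0.
    have -> : px * dy - py * dx = (dy * X - dx * Y) / (m k0 + m k1 + m k2).
      by rewrite /X /Y; field.
    by rewrite hx hy !mulr0 subr0 mul0r.
  set Z := (X in X = 0).
  have -> : Z = m k0 * m k1 * (s1 - s0) * (px * dy - py * dx) by rewrite /Z; ring.
  by rewrite pd0 mulr0.
move/eqP; rewrite !mulf_eq0 !(gt_eqF (m_gt0 _)) /= => /eqP q01.
have q2 d : cross d (q k0) = 0 -> cross d (q k1) = 0 -> cross d (q k2) = 0.
  move=> d0 d1; apply: (mulfI (lt0r_neq0 (m_gt0 k2))); rewrite mulr0.
  transitivity (complex.Re d * 0 - complex.Im d * 0 - m k0 * cross d (q k0)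
    - m k1 * cross d (q k1)); last by rewrite d0 d1; ring.
  by rewrite -[in complex.Re d * 0]qcy -[in complex.Im d * 0]qcx /cross; ring.
have q00 : cross (q k0) (q k0) = 0 by rewrite /cross; ring.
have q11 : cross (q k1) (q k1) = 0 by rewrite /cross; ring.
have q10 : cross (q k1) (q k0) = 0.
  by apply: oppr_inj; rewrite oppr0 -q01 /cross; ring.
(* The direction of the line is [q k0] if nonzero, else [q k1]; when both vanish so does [q k2], and
   the direction 1 is chosen. *)
have [q0|q0] := eqVneq (q k0) 0; last first.
  by apply: (cross_syzygy q0); apply: ord3P => //; exact: q2.
have [q1|q1] := eqVneq (q k1) 0; last first.
  by apply: (cross_syzygy q1); apply: ord3P => //; exact: q2.
have z0 : cross 1 (0 : R[i]) = 0 by rewrite /cross /= !mulr0 subr0.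
have c0 : cross 1 (q k0) = 0 by rewrite q0.
have c1 : cross 1 (q k1) = 0 by rewrite q1.
by apply: (@cross_syzygy _ _ 1); [exact: oner_neq0|apply: ord3P => //; exact: q2].
Qed.

(** * The three-body equations in the coordinates [w_i = m_i z_i] *)

Lemma theta_gt0 (R : realType) (M r : R) : 0 < M -> 0 < r -> 0 < theta M r.
Proof. by move=> M0 r0; rewrite divr_gt0 ?sqrtr_gt0 ?powR_gt0. Qed.

Lemma sqr_theta (R : realType) (M r : R) : 0 < M -> 0 < r ->
  theta M r ^+ 2 = M * (r ^+ 3)^-1.
Proof.
move=> M0 r0; rewrite /theta expr_div_n sqr_sqrtr ?ltW //.
rewrite -(@powR_mulrn _ (r `^ (3 / 2)) 2) ?powR_ge0 // -powRrM -(@powR_mulrn _ r 3) ?ltW //.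
by congr (_ / _ `^ _); field.
Qed.

(* For a centred configuration on a line with coordinates [zeta_i], where
   [u1 = m0 zeta_0] and [u2 = m1 zeta_1], the form is
   [sum m_i zeta_i ^ 2 = M^-1 sum m_i m_j (zeta_i - zeta_j) ^ 2]. *)
Lemma gform_pairwise (R : realType) (m0 m1 m2 s01 s02 s12 s u1 u2 : R) :
  m0 != 0 -> m1 != 0 -> m2 != 0 ->
  let G := gform (m0^-1 + m2^-1) m2^-1 (m1^-1 + m2^-1) in
  G u1 u2 ((m1 * s01 + (m0 + m2) * s02) * u1 + m0 * (s02 - s01) * u2)
    (m1 * (s12 - s01) * u1 + (m0 * s01 + (m1 + m2) * s12) * u2) -
  (m0 + m1 + m2) * s * G u1 u2 u1 u2 =
  m0 * m1 * (s01 - s) * (u1 / m0 - u2 / m1) ^+ 2 +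
  m0 * m2 * (s02 - s) * (u1 / m0 + (u1 + u2) / m2) ^+ 2 +
  m1 * m2 * (s12 - s) * (u2 / m1 + (u1 + u2) / m2) ^+ 2.
Proof. by move=> m0_neq0 m1_neq0 m2_neq0; rewrite /gform /=; field; apply/and3P. Qed.

(** Once the third body is eliminated by centering, the difference of the two sides is exactly the
    angular momentum divided by [d]. *)
Lemma gform_selfadjoint (R : realType)
    (m0 m1 m2 X0 X1 X2 Y0 Y1 Y2 P0 P1 P2 Q0 Q1 Q2 : R) :
  m0 != 0 -> m1 != 0 -> m2 != 0 ->
  m0 * X0 + m1 * X1 + m2 * X2 = 0 -> m0 * Y0 + m1 * Y1 + m2 * Y2 = 0 ->
  m0 * P0 + m1 * P1 + m2 * P2 = 0 -> m0 * Q0 + m1 * Q1 + m2 * Q2 = 0 ->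
  m0 * (X0 * Q0 - Y0 * P0) + m1 * (X1 * Q1 - Y1 * P1) + m2 * (X2 * Q2 - Y2 * P2) = 0 ->
  let d := m0 * X0 * (m1 * Y1) - m1 * X1 * (m0 * Y0) in
  let c11 := (m0 * P0 * (m1 * Y1) - m0 * Q0 * (m1 * X1)) / d in
  let c12 := (m0 * Q0 * (m0 * X0) - m0 * P0 * (m0 * Y0)) / d in
  let c21 := (m1 * P1 * (m1 * Y1) - m1 * Q1 * (m1 * X1)) / d in
  let c22 := (m1 * Q1 * (m0 * X0) - m1 * P1 * (m0 * Y0)) / d in
  (m0^-1 + m2^-1) * c12 + m2^-1 * c22 = m2^-1 * c11 + (m1^-1 + m2^-1) * c21.
Proof.
move=> m0_neq0 m1_neq0 m2_neq0 Xc Yc Pc Qc ang.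
have third (A B C : R) : m0 * A + m1 * B + m2 * C = 0 -> C = - (m0 * A + m1 * B) / m2.
  move=> h; have -> : m0 * A + m1 * B = - (m2 * C) by apply/eqP; rewrite -addr_eq0 h.
  by rewrite opprK mulrC mulKf.
rewrite (third _ _ _ Xc) (third _ _ _ Yc) (third _ _ _ Pc) (third _ _ _ Qc) in ang.
move=> d; apply/eqP; rewrite -subr_eq0 -(mul0r d^-1) -ang; apply/eqP.
by move: d^-1 => dV /=; field; apply/and3P.
Qed.

(** Centering removes [X2], so that the force on a body becomes a row of the matrix [A] applied to
    the coordinates [m_i X_i]. *)
Lemma centered_newton_row (R : realType) (m0 m1 m2 X0 X1 X2 s01 s02 : R) :
  m0 * X0 + m1 * X1 + m2 * X2 = 0 ->
  m0 * (m1 * ((X1 - X0) * s01) + m2 * ((X2 - X0) * s02)) =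
  - ((m1 * s01 + (m0 + m2) * s02) * (m0 * X0) + m0 * (s02 - s01) * (m1 * X1)).
Proof.
by move=> Xc; rewrite -[RHS]addr0 -[in RHS](mulr0 (m0 * s02)) -Xc; ring.
Qed.

(** * Bounds on the first syzygy time *)

Theorem theorem2p2 (R : realType) (m : 'I_3 -> R) (a : \bar R)
    (z v : R -> config R) (alpha beta Ts : R) (lambda1 lambda2 : R[i])
    (m_gt0 : forall k, 0 < m k) (a_gt0 : (0 < a)%E)
    (sol : three_body_solution m (time_dom a) z v)
    (zero_angmom : forall t, time_dom a t -> angular_momentum m (z t) (v t) = 0)
    (not_syzygy0 : ~ syzygy (z 0))
    (alpha_gt0 : 0 < alpha) (alpha_lt_beta : alpha < beta)
    (dist_bounds : forall t, time_dom a t -> forall i j : 'I_3, (i < j)%N ->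
       alpha <= cmod (z t i - z t j) <= beta)
    (eigen_C0 :
       let C0 := config_mx m (v 0) *m invmx (config_mx m (z 0)) in
       are_eigenvalues (map_mx (real_complex R) C0) lambda1 lambda2)
    (first_syzygy : first_syzygy_time (time_dom a) z Ts) :
  let M := \sum_k m k in
  let theta_alpha := theta M alpha in
  let theta_beta := theta M beta in
  let pi_s := Num.min (complex.Re lambda1) (complex.Re lambda2) in
  [/\ complex.Im lambda1 = 0, complex.Im lambda2 = 0 &
      theta_alpha^-1 * arccot (- (pi_s / theta_alpha)) <= Ts
        <= theta_beta^-1 * arccot (- (pi_s / theta_beta))].
Proof.
move=> M theta_alpha theta_beta pi_s.
have [DTs Ts_gt0 syzTs nosyz] := first_syzygy.
have Dt t : 0 <= t <= Ts -> time_dom a t.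
  case/andP=> t_ge0 tT; split=> //; case: DTs => _; apply: le_lt_trans.
  by rewrite lee_fin.
have oc t : 0 <= t < Ts -> 0 <= t <= Ts by case/andP => -> /ltW.
have D0 : time_dom a 0 by [].
set k0 := @Ordinal 3 0 isT; set k1 := @Ordinal 3 1 isT; set k2 := @Ordinal 3 2 isT.
have mi k : m k != 0 by rewrite gt_eqF.
have ME : M = m k0 + m k1 + m k2 by rewrite /M big_ord3.
have M_gt0 : 0 < M by rewrite ME !addr_gt0.
have beta_gt0 : 0 < beta by exact: lt_trans alpha_lt_beta.
have extend (f l : R -> R) :
    (forall t, time_dom a t -> has_deriv_in (time_dom a) f t (l t)) ->
    exists g, (forall t, 0 <= t -> g t = f t) /\
      forall t, time_dom a t -> is_derive t 1 g (l t).
  by move=> fl; have [g gf dg] := has_deriv_in_extension a_gt0 fl; exists g.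
(* Positions and velocities are replaced by functions that agree with them for [t >= 0] and have
   ordinary derivatives at 0 as well. *)
have /choice[X XP] : forall k, exists g, (forall t, 0 <= t -> g t = complex.Re (z t k)) /\
    forall t, time_dom a t -> is_derive t 1 g (complex.Re (v t k)).
  by move=> k; apply: extend => t Dtt; have [] := sol_velocity sol k Dtt.
have /choice[Y YP] : forall k, exists g, (forall t, 0 <= t -> g t = complex.Im (z t k)) /\
    forall t, time_dom a t -> is_derive t 1 g (complex.Im (v t k)).
  by move=> k; apply: extend => t Dtt; have [] := sol_velocity sol k Dtt.
have /choice[P PP] : forall k, exists g, (forall t, 0 <= t -> g t = complex.Re (v t k)) /\
    forall t, time_dom a t -> is_derive t 1 g (complex.Re (newton_field m (z t) k)).
  by move=> k; apply: extend => t Dtt; have [] := sol_newton sol k Dtt.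
have /choice[Q QP] : forall k, exists g, (forall t, 0 <= t -> g t = complex.Im (v t k)) /\
    forall t, time_dom a t -> is_derive t 1 g (complex.Im (newton_field m (z t) k)).
  by move=> k; apply: extend => t Dtt; have [] := sol_newton sol k Dtt.
have XE k t : time_dom a t -> X k t = complex.Re (z t k) by case=> t0 _; case: (XP k) => ->.
have YE k t : time_dom a t -> Y k t = complex.Im (z t k) by case=> t0 _; case: (YP k) => ->.
have PE k t : time_dom a t -> P k t = complex.Re (v t k) by case=> t0 _; case: (PP k) => ->.
have QE k t : time_dom a t -> Q k t = complex.Im (v t k) by case=> t0 _; case: (QP k) => ->.
(* Inverse cubes of the mutual distances; the entries [a11] to [a22] of [A] are built from them. *)
pose s i j t := (cmod (z t i - z t j) ^+ 3)^-1.
pose x1 t := m k0 * X k0 t; pose y1 t := m k0 * Y k0 t.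
pose x2 t := m k1 * X k1 t; pose y2 t := m k1 * Y k1 t.
pose p1 t := m k0 * P k0 t; pose q1 t := m k0 * Q k0 t.
pose p2 t := m k1 * P k1 t; pose q2 t := m k1 * Q k1 t.
pose a11 t := m k1 * s k0 k1 t + (m k0 + m k2) * s k0 k2 t.
pose a12 t := m k0 * (s k0 k2 t - s k0 k1 t).
pose a21 t := m k1 * (s k1 k2 t - s k0 k1 t).
pose a22 t := m k0 * s k0 k1 t + (m k1 + m k2) * s k1 k2 t.
pose d t := x1 t * y2 t - x2 t * y1 t.
have dE t : time_dom a t -> d t = \det (config_mx m (z t)).
  by move=> Dtt; rewrite det_config_mx /cross /d /x1 /x2 /y1 /y2 !XE // !YE //; ring.
have d_neq0 t : 0 <= t < Ts -> d t != 0.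
  move=> tT; rewrite dE; last exact/Dt/oc.
  apply/eqP => /(syzygy_det0 m_gt0 (sol_center sol (Dt _ (oc _ tT)))).
  (* [first_syzygy] speaks of positive times only; time 0 is covered by [not_syzygy0]. *)
  have [t0|t_neq0] := eqVneq t 0; first by rewrite t0.
  by case/andP: tT => t_ge0 tT; apply: nosyz; [exact/Dt/oc/andP| rewrite lt_def t_neq0|].
have dTs : d Ts = 0 by rewrite dE //; exact/(syzygy_det0 m_gt0 (sol_center sol DTs)).
have Xc t : time_dom a t -> m k0 * X k0 t + m k1 * X k1 t + m k2 * X k2 t = 0.
  by move=> Dtt; rewrite -(Re_centered (sol_center sol Dtt)) big_ord3 !XE.
have Yc t : time_dom a t -> m k0 * Y k0 t + m k1 * Y k1 t + m k2 * Y k2 t = 0.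
  by move=> Dtt; rewrite -(Im_centered (sol_center sol Dtt)) big_ord3 !YE.
have Pc t : time_dom a t -> m k0 * P k0 t + m k1 * P k1 t + m k2 * P k2 t = 0.
  by move=> Dtt; rewrite -(Re_centered (sol_momentum sol Dtt)) big_ord3 !PE.
have Qc t : time_dom a t -> m k0 * Q k0 t + m k1 * Q k1 t + m k2 * Q k2 t = 0.
  by move=> Dtt; rewrite -(Im_centered (sol_momentum sol Dtt)) big_ord3 !QE.
have dX t : time_dom a t ->
    [/\ is_derive t 1 x1 (p1 t), is_derive t 1 y1 (q1 t),
        is_derive t 1 x2 (p2 t) & is_derive t 1 y2 (q2 t)].
  move=> Dtt; rewrite /p1 /p2 /q1 /q2 !PE // !QE //.
  have [dX0 dX1] := ((XP k0).2 t Dtt, (XP k1).2 t Dtt).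
  have [dY0 dY1] := ((YP k0).2 t Dtt, (YP k1).2 t Dtt).
  by split; exact: is_deriveZ.
have dP t : time_dom a t ->
    [/\ is_derive t 1 p1 (- (a11 t * x1 t + a12 t * x2 t)),
        is_derive t 1 q1 (- (a11 t * y1 t + a12 t * y2 t)),
        is_derive t 1 p2 (- (a21 t * x1 t + a22 t * x2 t)) &
        is_derive t 1 q2 (- (a21 t * y1 t + a22 t * y2 t))].
  move=> Dtt; have [dP0 dP1] := ((PP k0).2 t Dtt, (PP k1).2 t Dtt).
  have [dQ0 dQ1] := ((QP k0).2 t Dtt, (QP k1).2 t Dtt).
  rewrite (Re_newton_field _ _ k0) big_mkcond big_ord3 -/k0 -/k1 -/k2 /= -!XE // in dP0.
  rewrite (Re_newton_field _ _ k1) big_mkcond big_ord3 -/k0 -/k1 -/k2 /= -!XE // in dP1.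
  rewrite (Im_newton_field _ _ k0) big_mkcond big_ord3 -/k0 -/k1 -/k2 /= -!YE // in dQ0.
  rewrite (Im_newton_field _ _ k1) big_mkcond big_ord3 -/k0 -/k1 -/k2 /= -!YE // in dQ1.
  split; apply: is_derive_eq; rewrite /GRing.scale /= ?add0r ?addr0.
  - by rewrite (cmodC (z t k1)) (cmodC (z t k2)) centered_newton_row // Xc.
  - by rewrite (cmodC (z t k1)) (cmodC (z t k2)) centered_newton_row // Yc.
  (* The row of body [k1] is the same identity with the roles of [k0] and [k1] exchanged, hence the
     commuted sums. *)
  - rewrite (cmodC (z t k2)) centered_newton_row; last by rewrite (addrC (m k1 * _)) Xc.
    by rewrite addrC.
  - rewrite (cmodC (z t k2)) centered_newton_row; last by rewrite (addrC (m k1 * _)) Yc.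
    by rewrite addrC.
(* The Gram matrix of [G], whose determinant is [M / (m k0 * m k1 * m k2)]. *)
pose g11 := (m k0)^-1 + (m k2)^-1; pose g12 := (m k2)^-1.
pose g22 := (m k1)^-1 + (m k2)^-1.
have g11_gt0 : 0 < g11 by rewrite addr_gt0 ?invr_gt0.
have g_gt0 : g12 ^+ 2 < g11 * g22.
  rewrite -subr_gt0; set U := (X in 0 < X).
  have -> : U = M / (m k0 * m k1 * m k2).
    by rewrite /U /g11 /g12 /g22 ME; field; rewrite !mi.
  by rewrite divr_gt0 ?mulr_gt0.
have dist t (i j : 'I_3) : time_dom a t -> (i < j)%N ->
    (beta ^+ 3)^-1 <= s i j t <= (alpha ^+ 3)^-1.
  move=> Dtt ij; have /andP[h1 h2] := dist_bounds t Dtt i j ij.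
  have r_gt0 : 0 < cmod (z t i - z t j) by exact: lt_le_trans h1.
  by rewrite !lef_pV2 ?posrE ?exprn_gt0 // !lerXn2r ?nnegrE // ltW.
have mm_ge0 i j : 0 <= m i * m j by rewrite mulr_ge0 ?ltW.
(* As [theta_beta ^ 2] is [M] over [beta ^ 3], [gform_pairwise] writes the difference as squares
   weighted by [s i j t - (beta ^ 3)^-1], which the distance bounds make nonnegative. *)
have A_ge t u1 u2 : 0 <= t < Ts ->
    theta_beta ^+ 2 * gform g11 g12 g22 u1 u2 u1 u2 <=
    gform g11 g12 g22 u1 u2 (a11 t * u1 + a12 t * u2) (a21 t * u1 + a22 t * u2).
  move=> /oc/Dt Dtt; rewrite /theta_beta sqr_theta // ME -subr_ge0 gform_pairwise //.
  have /andP[s01 _] := dist t k0 k1 Dtt isT.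
  have /andP[s02 _] := dist t k0 k2 Dtt isT.
  have /andP[s12 _] := dist t k1 k2 Dtt isT.
  by apply: addr_ge0; [apply: addr_ge0|]; rewrite mulr_ge0 ?sqr_ge0 // mulr_ge0 // subr_ge0.
have A_le t u1 u2 : 0 <= t <= Ts ->
    gform g11 g12 g22 u1 u2 (a11 t * u1 + a12 t * u2) (a21 t * u1 + a22 t * u2) <=
    theta_alpha ^+ 2 * gform g11 g12 g22 u1 u2 u1 u2.
  move=> /Dt Dtt; rewrite /theta_alpha sqr_theta // ME -subr_le0 gform_pairwise //.
  have /andP[_ s01] := dist t k0 k1 Dtt isT.
  have /andP[_ s02] := dist t k0 k2 Dtt isT.
  have /andP[_ s12] := dist t k1 k2 Dtt isT.
  rewrite -oppr_ge0 !opprD.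
  by apply: addr_ge0; [apply: addr_ge0|];
    rewrite -mulNr mulr_ge0 ?sqr_ge0 // -mulrN opprB mulr_ge0 // subr_ge0.
pose c11 t := (p1 t * y2 t - q1 t * x2 t) / d t.
pose c12 t := (q1 t * x1 t - p1 t * y1 t) / d t.
pose c21 t := (p2 t * y2 t - q2 t * x2 t) / d t.
pose c22 t := (q2 t * x1 t - p2 t * y1 t) / d t.
have sym t : time_dom a t -> g11 * c12 t + g12 * c22 t = g12 * c11 t + g22 * c21 t.
  move=> Dtt.
  apply: (gform_selfadjoint _ _ _ (Xc t Dtt) (Yc t Dtt) (Pc t Dtt) (Qc t Dtt)) => //.
  by rewrite -(zero_angmom t Dtt) /angular_momentum big_ord3 !XE ?YE ?PE ?QE.
have T0 : 0 <= (0 : R) < Ts by rewrite lexx.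
set C0 := config_mx m (v 0) *m invmx (config_mx m (z 0)) in eigen_C0.
have detX0 : \det (config_mx m (z 0)) != 0 by rewrite -dE // d_neq0.
have w0 : widen_ord (leqnSn 2) 0 = k0 by exact: val_inj.
have w1 : widen_ord (leqnSn 2) 1 = k1 by exact: val_inj.
have C00 : C0 0 0 = c11 0.
  by rewrite (mulmx_invmx22 _ 0 detX0).1 -dE // !mxE /= w0 w1 -!XE // -!YE // -PE // -QE.
have C01 : C0 0 1 = c12 0.
  by rewrite (mulmx_invmx22 _ 0 detX0).2 -dE // !mxE /= w0 -!XE // -!YE // -PE // -QE.
have C10 : C0 1 0 = c21 0.
  by rewrite (mulmx_invmx22 _ 1 detX0).1 -dE // !mxE /= w1 -!XE // -!YE // -PE // -QE.
have C11 : C0 1 1 = c22 0.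
  by rewrite (mulmx_invmx22 _ 1 detX0).2 -dE // !mxE /= w0 w1 -!XE // -!YE // -PE // -QE.
have disc : 4 * \det C0 <= (\tr C0) ^+ 2.
  rewrite det_mx22 mxtrace22 C00 C01 C10 C11.
  exact: symmetric_discriminant_ge0 g11_gt0 g_gt0 (sym 0 D0).
have [im1 im2 trE detE] := real_eigenvalues eigen_C0 disc.
(* Passing to the ordered pair [pi_s <= l2] preserves the sum and the product of the eigenvalues. *)
pose l2 := Num.max (complex.Re lambda1) (complex.Re lambda2).
have trl : c11 0 + c22 0 = pi_s + l2.
  by rewrite addr_min_max trE mxtrace22 C00 C11.
have detl : c11 0 * c22 0 - c12 0 * c21 0 = pi_s * l2.
  rewrite -C00 -C11 -C01 -C10 -det_mx22 -detE /pi_s /l2.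
  by case: leP => // _; rewrite mulrC.
have l12 : pi_s <= l2 by rewrite ge_min le_max lexx.
split=> //; apply/andP; split; rewrite arccotN.
- apply: (@linear_motion_lower_bound _ g11 g12 g22 theta_alpha Ts pi_s
    x1 y1 x2 y2 p1 q1 p2 q2 a11 a12 a21 a22) => //.
  + exact: theta_gt0.
  + by move=> t /Dt/dX.
  + by move=> t /Dt/dP.
  + by move=> u1 u2; exact: gform_min_eigenvalue g11_gt0 g_gt0 (sym 0 D0) trl detl l12.
(* [pi_s] is a root of the characteristic polynomial of [C0], by the trace and determinant
   relations, so it has an eigenvector. *)
- have [e1 [e2 [e_neq0 Ce1 Ce2]]] : exists e1 e2, [/\ (e1 != 0) || (e2 != 0),
      c11 0 * e1 + c12 0 * e2 = pi_s * e1 & c21 0 * e1 + c22 0 * e2 = pi_s * e2].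
    apply: eigenvector2; apply/eqP; rewrite -subr_eq0; apply/eqP.
    transitivity (c11 0 * c22 0 - c12 0 * c21 0 - pi_s * (c11 0 + c22 0) + pi_s * pi_s).
      by ring.
    by rewrite trl detl; ring.
  apply: (@linear_motion_upper_bound _ g11 g12 g22 theta_beta Ts pi_s e1 e2
    x1 y1 x2 y2 p1 q1 p2 q2 a11 a12 a21 a22) => //.
  + exact: theta_gt0.
  + by move=> t /oc/Dt/dX.
  + by move=> t /oc/Dt/dP.
  + by move=> t /oc/Dt/sym.
Qed.
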